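(* Fix an integer $\Delta\ge 2$ (treated as a constant). After a precomputation of a table of size $O(n^2)$ in time $O(n^2)$, there is an algorithm which, given the codeword of a tree $T\in T_n^\Delta$, computes the rank of $T$ (its position, starting from $1$, in the list of all trees of $T_n^\Delta$ sorted in A-order) in $O(n)$ time.
   Context: A $T^\Delta$ tree is an unlabeled ordered (plane) rooted tree in which every node has at most $\Delta$ children; $T_n^\Delta$ denotes the set of $T^\Delta$ trees with $n$ nodes. For a tree $T$, $|T|$ is its number of nodes, $\deg(T)$ the number of children of its root, and $T_1,T_2,\dots$ the subtrees rooted at the children of the root from left to right. A-order: for $T^\Delta$ trees $T,T'$ with $k=\max\{\deg(T),\deg(T')\}$, $T\prec_A T'$ iff either $|T|<|T'|$, or $|T|=|T'|$ and for some $1\le i\le k$ one has $T_j=_A T'_j$ for all $j<i$ and $T_i\prec_A T'_i$. The codeword of a $T^\Delta$ tree: the root is labeled $s$; for every internal node, if it has exactly one child that child is labeled $s$, otherwise its leftmost child is labeled $\ell$, its rightmost child $r$, and all children in between $m$; the codeword is the sequence of labels in pre-order. *)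

(* Defs.v *)
From HB Require Import structures.
From mathcomp Require Import all_boot.

Set Implicit Arguments.
Unset Strict Implicit.
Unset Printing Implicit Defensive.

(** * Plane rooted trees *)

Inductive tree : Type := Node of seq tree.

Definition children (t : tree) : seq tree := let: Node s := t in s.

Definition tree_nested_ind (P : tree -> Prop)
    (PNode : forall s, foldr (fun t => and (P t)) True s -> P (Node s)) :
    forall t, P t :=
  fix F (t : tree) : P t :=
    let: Node s := t in
    PNode s ((fix G (s : seq tree) : foldr (fun t => and (P t)) True s :=
      if s is u :: s' then conj (F u) (G s') else I) s).

Fixpoint tree_encode (t : tree) : GenTree.tree void :=
  let: Node s := t in GenTree.Node 0 (map tree_encode s).

Fixpoint tree_decode (g : GenTree.tree void) : tree :=
  if g is GenTree.Node _ s then Node (map tree_decode s) else Node [::].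

Lemma tree_encodeK : cancel tree_encode tree_decode.
Proof.
elim/tree_nested_ind => s /= IHs; congr Node; rewrite -map_comp.
by elim: s IHs => //= t s IHs [-> /IHs ->].
Qed.

HB.instance Definition _ := Countable.copy tree (can_type tree_encodeK).

Fixpoint nnodes (t : tree) : nat :=
  let: Node s := t in (sumn (map nnodes s)).+1.

Definition deg (t : tree) : nat := size (children t).

Fixpoint children_le (Delta : nat) (t : tree) : bool :=
  let: Node s := t in (size s <= Delta) && all (children_le Delta) s.

Definition TDelta (Delta n : nat) : pred tree :=
  [pred t | children_le Delta t & nnodes t == n].

(** * A-order *)

(* [subtree t i] is the mathematical T_(i+1); beyond the degree of the root it
   is the empty tree [None], of size 0. *)
Definition subtree (t : tree) (i : nat) : option tree := onth (children t) i.

Definition onnodes (o : option tree) : nat := if o is Some t then nnodes t else 0.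

Inductive ltA_opt : option tree -> option tree -> Prop :=
| ltA_size o o' : onnodes o < onnodes o' -> ltA_opt o o'
| ltA_subtree t t' i :
    nnodes t = nnodes t' ->
    i < maxn (deg t) (deg t') ->
    (forall j, j < i -> subtree t j = subtree t' j) ->
    ltA_opt (subtree t i) (subtree t' i) ->
    ltA_opt (Some t) (Some t').

Definition ltA (t t' : tree) : Prop := ltA_opt (Some t) (Some t').

Definition A_sorted_list (Delta n : nat) (s : seq tree) : Prop :=
  s =i TDelta Delta n /\
  forall i j, i < j < size s -> ltA (nth (Node [::]) s i) (nth (Node [::]) s j).

Definition is_rank (Delta n : nat) (t : tree) (r : nat) : Prop :=
  exists s : seq tree,
    [/\ A_sorted_list Delta n s, t \in s & r = (index t s).+1].

(** * Codewords *)

Inductive label : Type := Ls | Ll | Lm | Lr.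

(* Label of the child at position [i] (from 0) of a node with [d] children. *)
Definition child_label (d i : nat) : label :=
  if d == 1 then Ls
  else if i == 0 then Ll
  else if i == d.-1 then Lr
  else Lm.

(* Pre-order labels of all nodes but the root. *)
Fixpoint codeword_below (t : tree) : seq label :=
  let: Node s := t in
  flatten [seq p.1 :: p.2
          | p <- zip (mkseq (child_label (size s)) (size s))
                     (map codeword_below s)].

Definition codeword (t : tree) : seq label := Ls :: codeword_below t.

Definition label_code (x : label) : nat :=
  match x with Ls => 0 | Ll => 1 | Lm => 2 | Lr => 3 end.

(** * Uniform-cost random access machine *)

(* Registers and unbounded arrays of natural numbers.  A program names
   finitely many registers and arrays; array cells are addressed through
   registers.  Every elementary instruction and every test costs one unit,
   whatever the size of the numbers involved. *)
Record state : Type := State {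
  reg : nat -> nat;
  arr : nat -> nat -> nat
}.

Definition upd (T : Type) (f : nat -> T) (i : nat) (v : T) : nat -> T :=
  fun j => if j == i then v else f j.

Definition set_reg (st : state) (x v : nat) : state :=
  State (upd (reg st) x v) (arr st).

Definition set_arr (st : state) (a i v : nat) : state :=
  State (reg st) (upd (arr st) a (upd (arr st a) i v)).

Inductive binop : Type := Add | Sub | Mul.

(* [Sub] is truncated subtraction. *)
Definition eval_op (o : binop) : nat -> nat -> nat :=
  match o with Add => addn | Sub => subn | Mul => muln end.

Inductive program : Type :=
| Skip
| Const (x c : nat)                     (* r_x := c *)
| Op (x : nat) (o : binop) (y z : nat)  (* r_x := r_y o r_z *)
| Get (x a y : nat)                     (* r_x := a[r_y] *)
| Put (a x y : nat)                     (* a[r_x] := r_y *)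
| Seq (p q : program)
| If (x y : nat) (p q : program)        (* if r_x < r_y then p else q *)
| While (x y : nat) (p : program).      (* while r_x < r_y do p *)

(* [exec p st k st']: started in [st], [p] halts in [st'] after [k] units of
   time. *)
Inductive exec : program -> state -> nat -> state -> Prop :=
| exec_Skip st : exec Skip st 1 st
| exec_Const st x c : exec (Const x c) st 1 (set_reg st x c)
| exec_Op st x o y z :
    exec (Op x o y z) st 1 (set_reg st x (eval_op o (reg st y) (reg st z)))
| exec_Get st x a y :
    exec (Get x a y) st 1 (set_reg st x (arr st a (reg st y)))
| exec_Put st a x y :
    exec (Put a x y) st 1 (set_arr st a (reg st x) (reg st y))
| exec_Seq st st' st'' p q k l :
    exec p st k st' -> exec q st' l st'' -> exec (Seq p q) st (k + l) st''
| exec_If_true st st' x y p q k :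
    reg st x < reg st y -> exec p st k st' -> exec (If x y p q) st k.+1 st'
| exec_If_false st st' x y p q k :
    reg st y <= reg st x -> exec q st k st' -> exec (If x y p q) st k.+1 st'
| exec_While_false st x y p :
    reg st y <= reg st x -> exec (While x y p) st 1 st
| exec_While_true st st' st'' x y p k l :
    reg st x < reg st y -> exec p st k st' -> exec (While x y p) st' l st'' ->
    exec (While x y p) st (k + l).+1 st''.

Lemma exec_det p st k1 st1 k2 st2 :
  exec p st k1 st1 -> exec p st k2 st2 -> k1 = k2 /\ st1 = st2.
Proof.
move=> e; elim: e k2 st2 => {p st k1 st1}.
1-5: by move=> *; match goal with H : exec _ _ _ _ |- _ => inversion H end.
- move=> > _ IHp _ IHq k2 st2 e; inversion e as [| | | | |? ? ? ? ? ? ? ep eq| | | |].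
  by subst; case: (IHp _ _ ep) => ? ?; subst; case: (IHq _ _ eq) => -> ->.
- move=> > lt _ IHp k2 st2 e.
  inversion e as [| | | | | |? ? ? ? ? ? ? _ ep|? ? ? ? ? ? ? le| |]; subst.
    by case: (IHp _ _ ep) => -> ->.
  by move: lt; rewrite ltnNge le.
- move=> > le _ IHq k2 st2 e.
  inversion e as [| | | | | |? ? ? ? ? ? ? lt|? ? ? ? ? ? ? _ eq| |]; subst.
    by move: lt; rewrite ltnNge le.
  by case: (IHq _ _ eq) => -> ->.
- move=> > le k2 st2 e.
  inversion e as [| | | | | | | | |? ? ? ? ? ? ? ? lt]; subst => //.
  by move: lt; rewrite ltnNge le.
- move=> > lt _ IHp _ IHw k2 st2 e.
  inversion e as [| | | | | | | |? ? ? ? le|? ? ? ? ? ? ? ? _ ep ew]; subst.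
    by move: lt; rewrite ltnNge le.
  by case: (IHp _ _ ep) => ? ?; subst; case: (IHw _ _ ew) => -> ->.
Qed.

(** * Conventions for input and output *)

(* Register 0 holds [n] on input; it holds the numerical result on output.
   Array 0 is the input word and array 1 the precomputed table; all other
   registers and cells are initially 0. *)
Definition init_state (n : nat) (word table : seq nat) : state :=
  State (upd (fun=> 0) 0 n)
        (upd (upd (fun _ _ => 0) 0 (nth 0 word)) 1 (nth 0 table)).

Definition precomputes (pre : program) (n time : nat) (table : seq nat) : Prop :=
  exists k st,
    [/\ exec pre (init_state n [::] [::]) k st, k <= time
      & forall i, arr st 1 i = nth 0 table i].

Definition ranks (rk : program) (Delta n time : nat) (table : seq nat)
    (t : tree) : Prop :=
  exists k st,
    [/\ exec rk (init_state n (map label_code (codeword t)) table) k st,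
        k <= time
      & is_rank Delta n t (reg st 0)].

(* Main.v *)
Require Import Defs.
From mathcomp Require Import all_boot zify.

Set Implicit Arguments.
Unset Strict Implicit.
Unset Printing Implicit Defensive.

(** For trees with equally many nodes, the A-order compares the forests of
    subtrees of the roots lexicographically. Hence the forests of at most [d]
    trees and [m] nodes preceding [T :: F] fall into three groups: those whose
    first tree is smaller than [T], those whose first tree has the size of [T]
    but precedes it, and those starting with [T]. This gives
      [rank d (T :: F) =
         P d m (|T| - 1) + rank T * N (d - 1) |F| + rank (d - 1) F]
    where [N] counts forests and [P] is a prefix sum of products of values of
    [N]; the table holds all values of [P], and [N d m = P d m m].

    The labels [s] and [l] mark first children, the labels [l] and [m] mark
    nodes with a right sibling, and the subtree of the node at position [i] of
    the codeword is followed by its right sibling. So a single scan from right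
    to left computes, for every node, the size and the ranks of the forest
    formed by its subtree and those of its right siblings. The position of the
    node among its siblings is not known during the scan, so all [d <= Delta]
    are treated. *)

(** * Forests *)

Notation forest := (seq tree).

Definition forest_rect (P : forest -> Type) (P_nil : P [::])
    (P_cons : forall c r, P c -> P r -> P (Node c :: r)) (s : forest) : P s :=
  let fix on_children (t : tree) : P (children t) :=
    let: Node s := t in
    (fix on_forest (s : forest) : P s :=
      if s is t :: r then
        match t return P (children t) -> P (t :: r) with
        | Node c => fun Pc => P_cons c r Pc (on_forest r)
        end (on_children t)
      else P_nil) s
  in on_children (Node s).

Definition forest_size (s : forest) : nat := sumn (map nnodes s).

Lemma forest_size_cons c r :
  forest_size (Node c :: r) = (forest_size c + forest_size r).+1.
Proof. by []. Qed.

Lemma nnodes_Node s : nnodes (Node s) = (forest_size s).+1.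
Proof. by []. Qed.

(** * Counting and ranking forests *)

Lemma flatten_iota (w : nat -> nat) b M :
  flatten [seq iota (b + \sum_(i < k) w i) (w k) | k <- iota 0 M] =
  iota b (\sum_(i < M) w i).
Proof.
elim: M => [|M IH]; first by rewrite big_ord0.
rewrite -addn1 iotaD map_cat flatten_cat IH /= cats0.
by rewrite addn1 big_ord_recr iotaD.
Qed.

Lemma allpairs_iota b p q :
  [seq b + i * q + j | i <- iota 0 p, j <- iota 0 q] = iota b (p * q).
Proof.
have sumE k : \sum_(i < k) q = k * q by rewrite sum_nat_const card_ord.
rewrite -sumE -flatten_iota; congr flatten; apply: eq_map => i.
by rewrite sumE -[in RHS](addn0 (_ + _)) iotaDl.
Qed.

Section ForestRank.

Variable D : nat.

(* [N] is fuel. The forests are listed by the size of the first tree, then by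
   the first tree and then by the other trees, that is, in A-order. *)
Fixpoint forests_rec (N d m : nat) : seq forest :=
  match m, d, N with
  | 0, _, _ => [:: [::]]
  | m'.+1, d'.+1, N'.+1 =>
      flatten [seq [seq Node c :: r | c <- forests_rec N' D k,
                                      r <- forests_rec N' d' (m' - k)]
              | k <- iota 0 m'.+1]
  | _, _, _ => [::]
  end.

Definition forests (d m : nat) : seq forest := forests_rec m d m.

Definition nforests (d m : nat) : nat := size (forests d m).

Lemma forests_recSS N d m :
  forests_rec N.+1 d.+1 m.+1 =
  flatten [seq [seq Node c :: r | c <- forests_rec N D k,
                                  r <- forests_rec N d (m - k)]
          | k <- iota 0 m.+1].
Proof. by []. Qed.

Lemma forests_recE N d m : m <= N -> forests_rec N d m = forests d m.
Proof.
rewrite /forests; elim/ltn_ind: m N d => -[|m] IH [|N] [|d] // lemN.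
rewrite !forests_recSS; congr flatten; apply/eq_in_map => k.
by rewrite mem_iota => lek; rewrite !(IH k) ?(IH (m - k)) //; lia.
Qed.

Lemma forestsSS d m :
  forests d.+1 m.+1 =
  flatten [seq [seq Node c :: r | c <- forests D k, r <- forests d (m - k)]
          | k <- iota 0 m.+1].
Proof.
rewrite {1}/forests forests_recSS; congr flatten; apply/eq_in_map => k.
by rewrite mem_iota => lek; rewrite !forests_recE //; lia.
Qed.

Lemma mem_forests d m s :
  (s \in forests d m) =
  [&& size s <= d, all (children_le D) s & forest_size s == m].
Proof.
elim/ltn_ind: m d s => -[|m] IH d s.
  rewrite [LHS]inE; case: s => [|[c] r]; first by rewrite leq0n.
  by rewrite forest_size_cons !andbF.
case: d => [|d]; first by case: s.
rewrite forestsSS; apply/flatten_mapP/idP => [[k]|].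
  rewrite mem_iota => lek /allpairsP [[c r] /= []]; rewrite !IH; try lia.
  move=> /and3P [sc ac /eqP eqc] /and3P [sr ar /eqP eqr] ->.
  rewrite /= sc ac ar ltnS sr forest_size_cons eqc eqr; lia.
case: s => [//|[c] r]; rewrite forest_size_cons eqSS /= ltnS.
case/and3P=> sr /andP [/andP [sc ac] ar] /eqP eqm.
exists (forest_size c); first by rewrite (mem_iota 0 m.+1); lia.
apply/allpairsP; exists (c, r); rewrite /= !IH; try lia.
by rewrite sc ac sr ar -eqm addKn !eqxx.
Qed.

Lemma mem_forests_cons d m c r :
  (Node c :: r \in forests d.+1 m.+1) =
  [&& c \in forests D (forest_size c), r \in forests d (forest_size r)
    & forest_size c + forest_size r == m].
Proof.
rewrite !mem_forests forest_size_cons /= !eqxx !andbT ltnS eqSS -!andbA.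
by do 2!bool_congr.
Qed.

(* [prefix_count d m j] counts the forests in [forests d m] whose first tree has
   at most [j] nodes. The value [1] at [m = 0] makes the diagonal [j = m] equal
   to [nforests d m] without exception. *)
Definition prefix_count (d m j : nat) : nat :=
  match m, d with
  | 0, _ => 1
  | _.+1, 0 => 0
  | m'.+1, d'.+1 => \sum_(k < j) nforests D k * nforests d' (m' - k)
  end.

Lemma prefix_count_diag d m : prefix_count d m m = nforests d m.
Proof.
case: m d => [|m] [|d] //; rewrite /nforests forestsSS size_flatten /shape.
rewrite -map_comp sumnE big_map -[iota 0 _]/(index_iota 0 m.+1) big_mkord.
by apply: eq_bigr => k _; rewrite /= size_allpairs.
Qed.

Lemma prefix_count_col0 d m : prefix_count d m 0 = (m == 0).
Proof. by case: m d => [|m] [|d] //=; rewrite big_ord0. Qed.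

Lemma prefix_countS d m j :
  prefix_count d.+1 m.+1 j.+1 =
  prefix_count d.+1 m.+1 j + nforests D j * nforests d (m - j).
Proof. by rewrite /= big_ord_recr. Qed.

Lemma leq_prefix_count d m i j :
  i <= j -> prefix_count d m i <= prefix_count d m j.
Proof.
case: m d => [|m] [|d] // /subnKC <-.
by elim: (j - i) => [|l IH]; rewrite ?addn0 ?addnS ?prefix_countS //; lia.
Qed.

(* The value is meaningless if [s] has more than [d] trees. *)
Definition forest_rank (d : nat) (s : forest) : nat :=
  forest_rect (fun=> 0)
    (fun c r rank_c rank_r d =>
       if d is d'.+1 then
         prefix_count d (forest_size (Node c :: r)) (forest_size c)
         + rank_c D * nforests d' (forest_size r) + rank_r d'
       else 0) s d.

Lemma forest_rank_cons d c r :
  forest_rank d.+1 (Node c :: r) =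
  prefix_count d.+1 (forest_size c + forest_size r).+1 (forest_size c)
  + forest_rank D c * nforests d (forest_size r) + forest_rank d r.
Proof. by []. Qed.

Lemma map_forest_rank d m :
  map (forest_rank d) (forests d m) = iota 0 (nforests d m).
Proof.
elim/ltn_ind: m d => -[|m] IH [|d] //.
rewrite -prefix_count_diag forestsSS map_flatten -map_comp.
rewrite [prefix_count _ _ _]/=.
rewrite -(flatten_iota (fun k => nforests D k * nforests d (m - k))).
congr flatten; apply/eq_in_map => k; rewrite mem_iota /= => lek.
rewrite add0n -allpairs_iota -!IH; try lia.
rewrite map_allpairs allpairs_mapl allpairs_mapr; apply/eq_in_allpairs => c r.
rewrite !mem_forests => /and3P [_ _ /eqP eqc] /and3P [_ _ /eqP eqr].
by rewrite forest_rank_cons eqc eqr subnKC.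
Qed.

Lemma forest_rank_nth d m i :
  i < nforests d m -> forest_rank d (nth [::] (forests d m) i) = i.
Proof. by move=> lti; rewrite -(nth_map _ 0) // map_forest_rank nth_iota. Qed.

Lemma index_forests d m s :
  s \in forests d m -> index s (forests d m) = forest_rank d s.
Proof.
by move=> ms; rewrite -[in RHS](nth_index [::] ms) forest_rank_nth ?index_mem.
Qed.

Lemma ltn_forest_rank d m s :
  s \in forests d m -> forest_rank d s < nforests d m.
Proof. by move=> ms; rewrite -(index_forests ms) index_mem. Qed.

Lemma forest_rank_inj d m : {in forests d m &, injective (forest_rank d)}.
Proof.
by move=> s s' ms ms'; rewrite -!(index_forests (m := m)) //; apply: index_inj.
Qed.

Lemma forest_rank_cons_bounds d m c r :
  Node c :: r \in forests d.+1 m.+1 ->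
  prefix_count d.+1 m.+1 (forest_size c) <= forest_rank d.+1 (Node c :: r)
    < prefix_count d.+1 m.+1 (forest_size c).+1.
Proof.
rewrite mem_forests_cons => /and3P [/ltn_forest_rank ltc /ltn_forest_rank ltr].
by move/eqP=> <-; rewrite forest_rank_cons prefix_countS addKn; nia.
Qed.

End ForestRank.

(** * The A-order on forests *)

Definition forest_ltA (s s' : forest) : Prop :=
  exists i, [/\ i < maxn (size s) (size s'),
    forall j, j < i -> onth s j = onth s' j & ltA_opt (onth s i) (onth s' i)].

Lemma forest_ltA_head t t' r r' : ltA t t' -> forest_ltA (t :: r) (t' :: r').
Proof. by move=> ltt; exists 0; split; rewrite ?leq_max. Qed.

Lemma forest_ltA_tail t r r' : forest_ltA r r' -> forest_ltA (t :: r) (t :: r').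
Proof.
case=> i [lti eqr ltr]; exists i.+1; split; first by rewrite /= maxnSS ltnS.
  by case=> //= j /eqr.
exact: ltr.
Qed.

Lemma ltA_Node s s' :
  forest_size s = forest_size s' -> forest_ltA s s' -> ltA (Node s) (Node s').
Proof.
move=> eq_size [i [lti eqs lts]]; apply: (@ltA_subtree _ _ i) => //.
by rewrite !nnodes_Node eq_size.
Qed.

Lemma forest_rank_ltA D d m s s' :
  s \in forests D d m -> s' \in forests D d m ->
  forest_rank D d s < forest_rank D d s' -> forest_ltA s s'.
Proof.
elim/forest_rect: s d m s' => [|c r IHc IHr] d m [|[c'] r'].
- by [].
- rewrite !mem_forests => /and3P [_ _ /eqP <-].
  by rewrite forest_size_cons !andbF.
- by case: d.
case: m => [|m]; first by rewrite mem_forests forest_size_cons !andbF.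
case: d => [|d] // ms ms'.
have /andP [low_s up_s] := forest_rank_cons_bounds ms.
have /andP [low_s' up_s'] := forest_rank_cons_bounds ms'.
move: ms ms'; rewrite !mem_forests_cons.
move=> /and3P [mc mr /eqP eqm] /and3P [mc' mr' /eqP eqm'].
case: (ltngtP (forest_size c) (forest_size c')) => [ltc|ltc|eqc].
- by move=> _; apply/forest_ltA_head/ltA_size; apply: ltc.
- move=> /(leq_ltn_trans low_s)/ltn_trans/(_ up_s').
  by rewrite ltnNge leq_prefix_count.
have eqr : forest_size r' = forest_size r by lia.
rewrite !forest_rank_cons eqm eqm' -eqc eqr -!addnA ltn_add2l.
rewrite -eqc in mc'; rewrite eqr in mr'.
have [ltr ltr'] := (ltn_forest_rank mr, ltn_forest_rank mr').
case: (ltngtP (forest_rank D D c) (forest_rank D D c')) => [lt_c|lt_c|eq_c].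
- by move=> _; apply/forest_ltA_head/ltA_Node => //; apply: IHc mc mc' lt_c.
- by nia.
rewrite (forest_rank_inj mc mc' eq_c) ltn_add2l => /(IHr _ _ _ mr mr').
exact: forest_ltA_tail.
Qed.

Lemma TDelta_Node D n s :
  (Node s \in TDelta D n) = (s \in forests D D n.-1) && (0 < n).
Proof.
rewrite mem_forests inE nnodes_Node /=.
by case: n => [|n]; rewrite ?andbF //= andbT andbA.
Qed.

Lemma is_rank_forest_rank D n s :
  Node s \in TDelta D n -> is_rank D n (Node s) (forest_rank D D s).+1.
Proof.
have Node_inj : injective Node by move=> ? ? [].
rewrite TDelta_Node => /andP [ms n_gt0].
exists (map Node (forests D D n.-1)); split; last 2 first.
- exact: map_f.
- by rewrite index_map // index_forests.
split=> [[u]|i j]; first by rewrite TDelta_Node mem_map // n_gt0 andbT.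
rewrite size_map => /andP [ltij ltj]; have lti := ltn_trans ltij ltj.
have [mi mj] := (mem_nth [::] lti, mem_nth [::] ltj).
rewrite !(nth_map [::]) //; apply: ltA_Node; last first.
  by apply: (forest_rank_ltA mi mj); rewrite !forest_rank_nth.
move: mi mj; rewrite !mem_forests.
by move=> /and3P [_ _ /eqP ->] /and3P [_ _ /eqP ->].
Qed.

(** * Decoding codewords *)

Definition labels (d p : nat) (s : forest) : seq label :=
  forest_rect (fun _ _ => [::])
    (fun c r labels_c labels_r d p =>
       child_label d p :: labels_c (size c) 0 ++ labels_r d p.+1) s d p.

(* The forest listed for a node consists of its subtree and those of its right
   siblings. *)
Definition preorder_forests (s : forest) : seq forest :=
  forest_rect [::] (fun c r forests_c forests_r =>
                      (Node c :: r) :: forests_c ++ forests_r) s.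

Lemma labels_cons d p c r :
  labels d p (Node c :: r) =
  child_label d p :: labels (size c) 0 c ++ labels d p.+1 r.
Proof. by []. Qed.

Lemma preorder_forests_cons c r :
  preorder_forests (Node c :: r) =
  (Node c :: r) :: preorder_forests c ++ preorder_forests r.
Proof. by []. Qed.

Lemma labelsE d p s :
  labels d p s =
  flatten [seq q.1 :: q.2 | q <- zip (map (child_label d) (iota p (size s)))
                                     (map codeword_below s)].
Proof.
elim/forest_rect: s d p => // c r IHc IHr d p.
by rewrite labels_cons IHc IHr.
Qed.

Lemma codewordE t : codeword t = labels 1 0 [:: t].
Proof. by rewrite labelsE; case: t => s; rewrite /= cats0. Qed.

Lemma size_labels d p s : size (labels d p s) = forest_size s.
Proof.
elim/forest_rect: s d p => // c r IHc IHr d p.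
by rewrite labels_cons /= size_cat IHc IHr.
Qed.

Lemma size_preorder_forests s : size (preorder_forests s) = forest_size s.
Proof.
by elim/forest_rect: s => // c r IHc IHr; rewrite /= size_cat IHc IHr.
Qed.

Lemma size_codeword t : size (codeword t) = nnodes t.
Proof. by rewrite codewordE size_labels /forest_size /= addn0. Qed.

Lemma head_preorder_forests s : head [::] (preorder_forests s) = s.
Proof. by case: s => [|[]]. Qed.

Definition first_label (x : label) : bool := label_code x < 2.

Definition has_next_label (x : label) : bool := 0 < label_code x < 3.

Lemma first_child_label d p : p < d -> first_label (child_label d p) = (p == 0).
Proof.
rewrite /child_label; case: eqP => [->|d1]; first by case: p.
by case: eqP => // p0; case: eqP.
Qed.

Lemma has_next_child_label d p :
  p < d -> has_next_label (child_label d p) = (p.+1 < d).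
Proof.
rewrite /child_label; case: eqP => [->|d1]; first by case: p.
by case: eqP => [->|p0]; last case: eqP; rewrite /has_next_label /=; lia.
Qed.

Fixpoint decode (w : seq label) : seq forest :=
  if w is x :: w' then
    let z := decode w' in
    let c := if first_label (head Lr w') then head [::] z else [::] in
    let r := if has_next_label x then nth [::] z (forest_size c) else [::] in
    (Node c :: r) :: z
  else [::].

Lemma size_decode w : size (decode w) = size w.
Proof. by elim: w => //= x w ->. Qed.

Lemma decode_labels_cat d p s w :
  p + size s = d -> ~~ first_label (head Lr w) ->
  decode (labels d p s ++ w) = preorder_forests s ++ decode w.
Proof.
elim/forest_rect: s d p w => // c r IHc IHr d p w size_d w_head.
have {}IHr := IHr d p.+1 w (etrans (addSnnS _ _) size_d) w_head.
have r_head : ~~ first_label (head Lr (labels d p.+1 r ++ w)).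
  case: r size_d {IHr} => [|[b] r] //= size_d.
  by rewrite first_child_label //; lia.
rewrite labels_cons preorder_forests_cons /= -!catA IHc // IHr.
have -> :
    (if first_label (head Lr (labels (size c) 0 c ++ labels d p.+1 r ++ w))
     then head [::] (preorder_forests c ++ preorder_forests r ++ decode w)
     else [::]) = c.
  case: c {IHc size_d} => [|[b] c] /=; first by rewrite (negPf r_head).
  by rewrite first_child_label.
rewrite has_next_child_label; last by move: size_d => /=; lia.
rewrite nth_cat size_preorder_forests ltnn subnn.
by case: r size_d {IHr r_head} => [|[b] r] /= size_d; case: ifP => //; lia.
Qed.

Lemma decode_codeword t : decode (codeword t) = preorder_forests [:: t].
Proof. by rewrite codewordE -[labels _ _ _]cats0 decode_labels_cat ?cats0. Qed.

Section ForestAt.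

Variable w : seq label.

Definition forest_at (i : nat) : forest := nth [::] (decode w) i.

(* Beyond the end of [w] the default label [Ls], whose code 0 is also the
   content of an unwritten cell, wrongly announces a first child; this is
   harmless because the forest there is empty. *)
Definition child_forest (i : nat) : forest :=
  if first_label (nth Ls w i.+1) then forest_at i.+1 else [::].

Definition sibling_forest (i : nat) : forest :=
  if has_next_label (nth Ls w i)
  then forest_at (i.+1 + forest_size (child_forest i)) else [::].

Lemma forest_at_default i : size w <= i -> forest_at i = [::].
Proof. by move=> lewi; rewrite /forest_at nth_default ?size_decode. Qed.

Lemma mul_first_labelE (f : forest -> nat) i :
  f [::] = 0 ->
  first_label (nth Ls w i.+1) * f (forest_at i.+1) = f (child_forest i).
Proof. by rewrite /child_forest; case: ifP; rewrite ?mul1n ?mul0n. Qed.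

Lemma mul_has_next_labelE (f : forest -> nat) i :
  f [::] = 0 ->
  has_next_label (nth Ls w i)
    * f (forest_at (i.+1 + forest_size (child_forest i)))
  = f (sibling_forest i).
Proof. by rewrite /sibling_forest; case: ifP; rewrite ?mul1n ?mul0n. Qed.

End ForestAt.

Lemma forest_atE w i :
  i < size w -> forest_at w i = Node (child_forest w i) :: sibling_forest w i.
Proof.
elim: w i => // x w IH [|i] lti; last exact: IH.
rewrite /forest_at /sibling_forest [decode _]/= [nth Ls _ _]/= [nth _ _ 0]/=.
suff -> : (if first_label (head Lr w) then head [::] (decode w) else [::]) =
          child_forest (x :: w) 0 by [].
by case: w {IH lti}.
Qed.

Lemma leq_forest_size_at w i : forest_size (forest_at w i) <= size w - i.
Proof.
have [n] := ubnP (size w - i); elim: n i => // n IH i le_n.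
case: (ltnP i (size w)) => [lti|lei]; last by rewrite forest_at_default.
have size_c : forest_size (child_forest w i) <= size w - i.+1.
  by rewrite /child_forest; case: ifP => // _; apply: IH; lia.
rewrite forest_atE // forest_size_cons /sibling_forest.
case: ifP => _; last by rewrite addn0; lia.
have := IH (i.+1 + forest_size (child_forest w i)); lia.
Qed.

Lemma forest_at1_codeword t : forest_at (codeword t) 1 = children t.
Proof.
case: t => s; rewrite /forest_at decode_codeword preorder_forests_cons cats0.
by rewrite /= nth0 head_preorder_forests.
Qed.

(** * Compiling expressions and loops *)

Inductive expr : Type :=
| Var (x : nat)
| Lit (v : nat)
| Bin (o : binop) (e f : expr)
| Cell (a : nat) (e : expr).

Declare Scope expr_scope.
Delimit Scope expr_scope with E.
Bind Scope expr_scope with expr.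

Local Notation "e + f" := (Bin Add e f) : expr_scope.
Local Notation "e - f" := (Bin Defs.Sub e f) : expr_scope.
Local Notation "e * f" := (Bin Mul e f) : expr_scope.

Fixpoint eval (st : state) (e : expr) : nat :=
  match e with
  | Var x => reg st x
  | Lit v => v
  | Bin o e f => eval_op o (eval st e) (eval st f)
  | Cell a e => arr st a (eval st e)
  end.

(* Variables live in the even registers; the odd ones are scratch space. *)
Definition scratch (k : nat) : nat := k.*2.+1.

Fixpoint compile (k : nat) (e : expr) : program :=
  match e with
  | Var x => Seq (Const (scratch k) 0) (Op (scratch k) Add (scratch k) x.*2)
  | Lit v => Const (scratch k) v
  | Bin o e f =>
      Seq (compile k e)
        (Seq (compile k.+1 f) (Op (scratch k) o (scratch k) (scratch k.+1)))
  | Cell a e => Seq (compile k e) (Get (scratch k) a (scratch k))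
  end.

Fixpoint cost (e : expr) : nat :=
  match e with
  | Var _ => 2
  | Lit _ => 1
  | Bin _ e f => cost e + (cost f + 1)
  | Cell _ e => cost e + 1
  end.

Definition implements (mst st : state) : Prop :=
  (forall x, reg mst x.*2 = reg st x) /\ arr mst = arr st.

Lemma upd_eq T (f : nat -> T) i v : upd f i v i = v.
Proof. by rewrite /upd eqxx. Qed.

Lemma upd_neq T (f : nat -> T) i j v : j != i -> upd f i v j = f j.
Proof. by rewrite /upd => /negPf ->. Qed.

Lemma implements_scratch mst st k v :
  implements mst st -> implements (set_reg mst (scratch k) v) st.
Proof.
by case=> regE arrE; split=> // x; rewrite /= upd_neq ?regE // /scratch; lia.
Qed.

Lemma exec_compile k e mst st :
  implements mst st ->
  exists mst', [/\ exec (compile k e) mst (cost e) mst',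
    reg mst' (scratch k) = eval st e, implements mst' st
    & forall l, l < k -> reg mst' (scratch l) = reg mst (scratch l)].
Proof.
have scratch_neq l i : l < i -> scratch l != scratch i by rewrite /scratch; lia.
elim: e k mst => [x|v|o e IHe f IHf|a e IHe] k mst impl /=.
- eexists; split.
  + by apply: (@exec_Seq _ _ _ _ _ 1 1); constructor.
  + by rewrite /= !upd_eq /= upd_neq ?(proj1 impl) // /scratch; lia.
  + exact/implements_scratch/implements_scratch.
  + by move=> l ltl; rewrite /= !upd_neq // scratch_neq.
- eexists; split; first by constructor.
  + by rewrite /= upd_eq.
  + exact: implements_scratch.
  + by move=> l ltl; rewrite /= upd_neq // scratch_neq.
- have [mst1 [exec1 eval1 impl1 keep1]] := IHe k mst impl.
  have [mst2 [exec2 eval2 impl2 keep2]] := IHf k.+1 mst1 impl1.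
  eexists; split.
  + by apply: exec_Seq exec1 _; apply: exec_Seq exec2 _; constructor.
  + by rewrite /= upd_eq eval2 keep2 // eval1.
  + exact: implements_scratch.
  + by move=> l ltl; rewrite /= upd_neq ?scratch_neq // keep2 ?keep1 // ltnW.
- have [mst1 [exec1 eval1 impl1 keep1]] := IHe k mst impl.
  eexists; split; first by apply: exec_Seq exec1 _; constructor.
  + by rewrite /= upd_eq eval1 (proj2 impl1).
  + exact: implements_scratch.
  + by move=> l ltl; rewrite /= upd_neq ?scratch_neq // keep1.
Qed.

Inductive stmt : Type :=
| Assign (x : nat) (e : expr)
| Store (a : nat) (e f : expr).

Definition run_stmt (st : state) (s : stmt) : state :=
  match s with
  | Assign x e => set_reg st x (eval st e)
  | Store a e f => set_arr st a (eval st e) (eval st f)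
  end.

Definition run (st : state) (b : seq stmt) : state := foldl run_stmt st b.

Definition compile_stmt (s : stmt) : program :=
  match s with
  | Assign x e =>
      Seq (compile 0 e) (Seq (Const x.*2 0) (Op x.*2 Add x.*2 (scratch 0)))
  | Store a e f =>
      Seq (compile 0 e) (Seq (compile 1 f) (Put a (scratch 0) (scratch 1)))
  end.

Definition cost_stmt (s : stmt) : nat :=
  match s with
  | Assign _ e => cost e + 2
  | Store _ e f => cost e + (cost f + 1)
  end.

Definition block (b : seq stmt) : program :=
  foldr (fun s => Seq (compile_stmt s)) Skip b.

Definition cost_block (b : seq stmt) : nat := (sumn (map cost_stmt b)).+1.

Lemma exec_stmt s mst st :
  implements mst st ->
  exists2 mst', exec (compile_stmt s) mst (cost_stmt s) mst'
              & implements mst' (run_stmt st s).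
Proof.
case: s => [x e|a e f] impl /=.
  have [mst1 [exec1 eval1 [regE arrE] _]] := exec_compile 0 e impl.
  eexists.
    by apply: exec_Seq exec1 _; apply: (@exec_Seq _ _ _ _ _ 1 1); constructor.
  split=> // y; have [->|ney] := eqVneq y x.
    by rewrite /= !upd_eq upd_neq ?eval1 // /scratch; lia.
  by rewrite /= !upd_neq //; lia.
have [mst1 [exec1 eval1 impl1 _]] := exec_compile 0 e impl.
have [mst2 [exec2 eval2 [regE arrE] keep2]] := exec_compile 1 f impl1.
eexists; first by apply: exec_Seq exec1 _; apply: exec_Seq exec2 _; constructor.
by split=> //=; rewrite eval2 keep2 // eval1 arrE.
Qed.

Lemma exec_block b mst st :
  implements mst st ->
  exists2 mst', exec (block b) mst (cost_block b) mst'
              & implements mst' (run st b).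
Proof.
elim: b mst st => [|s b IH] mst st impl; first by exists mst; first constructor.
have [mst1 exec1 impl1] := exec_stmt s impl.
have [mst2 exec2 impl2] := IH _ _ impl1; exists mst2 => //.
by rewrite /cost_block /= -addnS; apply: exec_Seq exec1 exec2.
Qed.

Definition while_lt (x y : nat) (p : program) : program := While x.*2 y.*2 p.

Definition terminates (p : program) (time : nat) (st : state)
    (post : state -> Prop) : Prop :=
  forall mst, implements mst st ->
  exists k mst' st',
    [/\ exec p mst k mst', k <= time, implements mst' st' & post st'].

Lemma terminates_leq p time time' st post :
  time <= time' -> terminates p time st post -> terminates p time' st post.
Proof.
move=> le_time term mst /term [k [mst' [st' [ex le_k impl post_st']]]].
by exists k, mst', st'; split=> //; apply: leq_trans le_k le_time.
Qed.

Lemma terminates_block b st (post : state -> Prop) :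
  post (run st b) -> terminates (block b) (cost_block b) st post.
Proof.
move=> post_run mst /(exec_block b) [mst' ex impl].
by exists (cost_block b), mst', (run st b).
Qed.

Lemma terminates_seq p q tp tq st post :
  terminates p tp st (fun st' => terminates q tq st' post) ->
  terminates (Seq p q) (tp + tq) st post.
Proof.
move=> term mst /term [k [mst1 [st1 [ex1 le_k impl1 /(_ _ impl1)]]]].
case=> l [mst2 [st2 [ex2 le_l impl2 post2]]].
exists (k + l), mst2, st2; split=> //; last exact: leq_add.
exact: exec_Seq ex1 ex2.
Qed.

(* [inv k] holds when [k] more rounds are to come. *)
Lemma terminates_while (inv : nat -> state -> Prop) x y p time
    (post : state -> Prop) :
  (forall k st, inv k.+1 st ->
     reg st x < reg st y /\ terminates p time st (inv k)) ->
  (forall st, inv 0 st -> reg st y <= reg st x /\ post st) ->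
  forall k st, inv k st ->
  terminates (while_lt x y p) (k * time.+1).+1 st post.
Proof.
move=> round stop; elim=> [|k IH] st inv_st mst impl.
  have [le_yx post_st] := stop _ inv_st; exists 1, mst, st; split=> //.
  by apply: exec_While_false; rewrite !(proj1 impl).
have [lt_xy /(_ _ impl)] := round _ _ inv_st.
case=> [t1 [mst1 [st1 [ex1 le_t1 impl1 inv1]]]].
have [t2 [mst2 [st2 [ex2 le_t2 impl2 post2]]]] := IH _ inv1 _ impl1.
exists (t1 + t2).+1, mst2, st2; split=> //; last by rewrite mulSn; lia.
by apply: exec_While_true ex1 ex2; rewrite !(proj1 impl).
Qed.

Lemma implements_init_state n word table :
  implements (init_state n word table) (init_state n word table).
Proof. by split=> // -[|x]. Qed.

Lemma run_cat st b b' : run st (b ++ b') = run (run st b) b'.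
Proof. exact: foldl_cat. Qed.

Lemma run_map_iota (inv : nat -> state -> Prop) (f : nat -> stmt) k st :
  (forall d st', d < k -> inv d st' -> inv d.+1 (run_stmt st' (f d))) ->
  inv 0 st -> inv k (run st (map f (iota 0 k))).
Proof.
move=> step inv0; elim: k step => // k IH step.
rewrite -[in iota _ _]addn1 iotaD map_cat run_cat; apply: (step) => //.
by apply: IH => d st' ltdk; apply: step; apply: ltnW.
Qed.

(** * Precomputing the table *)

Definition table_index (n d m j : nat) : nat := (d * n + m) * n + j.

Lemma mixed_radix_inj n q r q' r' :
  r < n -> r' < n -> q * n + r = q' * n + r' -> q = q' /\ r = r'.
Proof.
move=> ltr ltr' eq_qr; have n_gt0 : 0 < n by lia.
have := congr1 (modn^~ n) eq_qr; have := congr1 (divn^~ n) eq_qr.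
by rewrite /= !divnMDl // !modnMDl !divn_small // !modn_small // !addn0.
Qed.

Lemma table_index_inj n d m j d' m' j' :
  m < n -> j < n -> m' < n -> j' < n ->
  table_index n d m j = table_index n d' m' j' -> [/\ d = d', m = m' & j = j'].
Proof.
move=> ltm ltj ltm' ltj' /mixed_radix_inj [//|//|].
by move=> /mixed_radix_inj [//|//|-> -> ->].
Qed.

Lemma ltn_table_index D n d m j :
  d <= D -> m < n -> j < n -> table_index n d m j < D.+1 * n * n.
Proof.
move=> le_dD ltm ltj; have lt_dm : d * n + m < D.+1 * n.
  by have := leq_mul le_dD (leqnn n); rewrite mulSn; lia.
by have := leq_mul lt_dm (leqnn n); rewrite /table_index mulSn; lia.
Qed.

Local Notation x_n := 0 (only parsing).
Local Notation x_row := 1 (only parsing).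
Local Notation x_col := 2 (only parsing).
Local Notation a_table := 1 (only parsing).

Definition address (d : nat) (m j : expr) : expr :=
  ((Lit d * Var x_n + m) * Var x_n + j)%E.

Definition entry (d : nat) (m j : expr) : expr := Cell a_table (address d m j).

Definition count_entry (d : nat) (m : expr) : expr := entry d m m.

Definition fill_column (D : nat) (j : expr) (value : nat -> expr) : seq stmt :=
  [seq Store a_table (address d (Var x_row) j) (value d) | d <- iota 0 D.+1].

Definition next_entry (D d : nat) : expr :=
  if d is d'.+1 then
    let rest := (Var x_row - Lit 1 - Var x_col)%E in
    (entry d (Var x_row) (Var x_col)
     + count_entry D (Var x_col) * count_entry d' rest)%E
  else Lit 0.

(* The subtraction is truncated: the value is 1 in row 0 and 0 in the others. *)
Definition first_column (D : nat) : seq stmt :=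
  fill_column D (Lit 0) (fun=> Lit 1 - Var x_row)%E ++
  [:: Assign x_col (Lit 0)].

Definition next_column (D : nat) : seq stmt :=
  fill_column D (Var x_col + Lit 1) (next_entry D) ++
  [:: Assign x_col (Var x_col + Lit 1)].

Definition next_row : seq stmt := [:: Assign x_row (Var x_row + Lit 1)].

Definition fill_row (D : nat) : program :=
  Seq (block (first_column D))
      (Seq (while_lt x_col x_row (block (next_column D))) (block next_row)).

Definition precomputation (D : nat) : program :=
  while_lt x_row x_n (fill_row D).

Section Precomputation.

Variables D n : nat.

Definition table_spec (T : nat -> nat) : Prop :=
  forall d m j, d <= D -> j <= m -> m < n ->
    T (table_index n d m j) = prefix_count D d m j.

Definition lex_lt (m j d m' j' d' : nat) : bool :=
  (m < m') || (m == m') && ((j < j') || (j == j') && (d < d')).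

Definition filled (m j d : nat) (T : nat -> nat) : Prop :=
  (forall d' m' j', d' <= D -> j' <= m' -> m' < n ->
     lex_lt m' j' d' m j d ->
     T (table_index n d' m' j') = prefix_count D d' m' j') /\
  (forall i, D.+1 * n * n <= i -> T i = 0).

Lemma filled_sub m1 j1 d1 m2 j2 d2 T :
  (forall m j d, d <= D -> j <= m ->
     lex_lt m j d m2 j2 d2 -> lex_lt m j d m1 j1 d1) ->
  filled m1 j1 d1 T -> filled m2 j2 d2 T.
Proof.
by move=> sub [Tin Tout]; split=> // d m j *; apply: Tin => //; apply: sub.
Qed.

Lemma filled_upd m j d T :
  d <= D -> j <= m -> m < n -> filled m j d T ->
  filled m j d.+1 (upd T (table_index n d m j) (prefix_count D d m j)).
Proof.
move=> le_dD le_jm ltmn [Tin Tout].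
split=> [d' m' j' le_dD' le_jm' ltmn'|i le_i].
  rewrite /upd; case: eqP => [|neq before].
    by case/table_index_inj; [lia..|move=> -> -> ->].
  have other : ~~ [&& d' == d, m' == m & j' == j].
    by apply: contra_notN neq => /and3P [/eqP -> /eqP -> /eqP ->].
  by apply: Tin => //; move: before other; rewrite /lex_lt; lia.
rewrite upd_neq ?Tout //; apply: contraTneq le_i => ->.
by rewrite -ltnNge ltn_table_index //; lia.
Qed.

Lemma run_fill_column m j je value st :
  reg st x_n = n -> reg st x_row = m -> j <= m -> m < n ->
  (forall st', reg st' = reg st -> eval st' je = j) ->
  (forall d st', d <= D -> reg st' = reg st -> filled m j d (arr st' a_table) ->
     eval st' (value d) = prefix_count D d m j) ->
  filled m j 0 (arr st a_table) ->
  let st' := run st (fill_column D je value) in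
  reg st' = reg st /\ filled m j.+1 0 (arr st' a_table).
Proof.
move=> st_n st_m le_jm ltmn jeE valueE filled0.
pose inv d st' := reg st' = reg st /\ filled m j d (arr st' a_table).
have [regE filledD] : inv D.+1 (run st (fill_column D je value)).
  apply: run_map_iota => // d st' le_dD [regE filled_d]; split=> //.
  rewrite /= upd_eq valueE // jeE // regE st_n st_m -/(table_index n d m j).
  exact: filled_upd.
split=> //; apply: filled_sub filledD => m' j' d' le_dD _.
by rewrite /lex_lt; lia.
Qed.

Definition at_column (m j : nat) (st : state) : Prop :=
  [/\ reg st x_n = n, reg st x_row = m, reg st x_col = j
    & filled m j.+1 0 (arr st a_table)].

Definition at_row (m : nat) (st : state) : Prop :=
  [/\ reg st x_n = n, reg st x_row = m & filled m 0 0 (arr st a_table)].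

Lemma run_first_column m st :
  m < n -> at_row m st -> at_column m 0 (run st (first_column D)).
Proof.
move=> ltmn [st_n st_m filled_m]; rewrite /first_column run_cat.
have [|d st' _ regE _|//|regE filled1] :=
  @run_fill_column m 0 (Lit 0) (fun=> Lit 1 - Var x_row)%E st
    st_n st_m (leq0n m) ltmn.
- by [].
- by rewrite /= regE st_m prefix_count_col0; case: (m).
by split; rewrite /= /upd //= regE.
Qed.

Lemma run_next_column m j st :
  j < m -> m < n -> at_column m j st ->
  at_column m j.+1 (run st (next_column D)).
Proof.
move=> ltjm ltmn [st_n st_m st_j filled_j]; rewrite /next_column run_cat.
have [st' regE|[|d] st' le_dD regE [Tin _]|//|regE filled1] :=
  @run_fill_column m j.+1 (Var x_col + Lit 1)%E (next_entry D) st
    st_n st_m ltjm ltmn.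
- by rewrite /= regE st_j addn1.
- by case: (m) ltjm.
- rewrite /= regE st_n st_m st_j -!/(table_index n _ _ _).
  rewrite !Tin; try (rewrite /lex_lt; lia).
  case: (m) ltjm => // k _.
  by rewrite prefix_countS !prefix_count_diag subn1.
by split; rewrite /= /upd //= regE ?st_j ?addn1.
Qed.

Lemma terminates_fill_row m st (post : state -> Prop) :
  m < n -> at_row m st -> (forall st', at_row m.+1 st' -> post st') ->
  terminates (fill_row D)
    (cost_block (first_column D)
     + ((n * (cost_block (next_column D)).+1).+1 + cost_block next_row))
    st post.
Proof.
move=> ltmn row_m post_next.
apply/terminates_seq/terminates_block/terminates_seq.
pose inv k st' := k <= m /\ at_column m (m - k) st'.
apply: (@terminates_leq _ (m * (cost_block (next_column D)).+1).+1).
  by rewrite ltnS leq_mul2r ltnW ?orbT.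
apply: (@terminates_while inv) => [k st' [ltkm col]|st' [_ col]|]; last first.
- by split=> //; rewrite subnn; apply: run_first_column.
- move: col; rewrite subn0 => -[st_n st_m st_j filled_m].
  split; first by rewrite st_m st_j.
  apply/terminates_block/post_next.
  split; rewrite /= /upd ?st_n ?st_m ?addn1 //=.
  by apply: filled_sub filled_m => m' j' d'; rewrite /lex_lt; lia.
split; first by case: col => _ -> -> _; lia.
apply: terminates_block; split; first exact: ltnW.
by rewrite (_ : m - k = (m - k.+1).+1); [apply: run_next_column => //|]; lia.
Qed.

Definition precomputation_rate : nat :=
  cost_block (first_column D) + cost_block (next_column D)
  + cost_block next_row + 4.

Lemma terminates_precomputation st :
  0 < n -> at_row 0 st ->
  terminates (precomputation D) (precomputation_rate * n ^ 2) st
    (fun st' => filled n 0 0 (arr st' a_table)).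
Proof.
move=> n_gt0 row_0; pose inv k st' := k <= n /\ at_row (n - k) st'.
apply: terminates_leq (@terminates_while inv _ _ _ _ _ _ _ n _ _); last first.
- by split=> //; rewrite subnn.
- by move=> st' [_]; rewrite subn0 => -[st_n st_m filled_n]; rewrite st_n st_m.
- move=> k st' [ltkn row_k]; split; first by case: row_k => -> -> _; lia.
  apply: (terminates_fill_row _ row_k) => [|st2 row_k1]; first lia.
  by split; [apply: ltnW|rewrite (_ : n - k = (n - k.+1).+1) //; lia].
rewrite /precomputation_rate -mulnn.
move: (cost_block _) (cost_block _) (cost_block _).
by move=> first_cost next_cost row_cost; nia.
Qed.

End Precomputation.

Lemma precomputes_table D n :
  0 < n ->
  exists table : seq nat,
    [/\ size table <= D.+1 * n ^ 2,
        precomputes (precomputation D) n (precomputation_rate D * n ^ 2) table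
      & table_spec D n (nth 0 table)].
Proof.
move=> n_gt0; set st := init_state n [::] [::].
have row_0 : at_row D n 0 st.
  split=> //; split=> [d m j _ _ _|i _]; last exact: nth_nil.
  by rewrite /lex_lt !ltn0 !andbF.
have [k [mst [st' [ex le_k [_ arrE] [Tin Tout]]]]] :=
  terminates_precomputation n_gt0 row_0 (implements_init_state _ _ _).
exists (mkseq (arr st' a_table) (D.+1 * n * n)); split.
- by rewrite size_mkseq -mulnA mulnn.
- exists k, mst; split=> // i; rewrite arrE.
  have [lti|lei] := ltnP i (D.+1 * n * n); first by rewrite nth_mkseq.
  by rewrite nth_default ?size_mkseq // Tout.
- move=> d m j le_dD le_jm ltmn.
  have ltjn := leq_ltn_trans le_jm ltmn; rewrite nth_mkseq ?ltn_table_index //.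
  by apply: Tin => //; rewrite /lex_lt ltmn.
Qed.

(** * Ranking by a scan of the codeword *)

Local Notation x_pos := 1 (only parsing).
Local Notation x_zero := 2 (only parsing).
Local Notation x_child := 3 (only parsing).
Local Notation x_child_size := 4 (only parsing).
Local Notation x_next := 5 (only parsing).
Local Notation x_next_size := 6 (only parsing).
Local Notation x_child_rank := 7 (only parsing).
Local Notation a_word := 0 (only parsing).
Local Notation a_size := 2 (only parsing).
Local Notation a_rank d := (3 + d) (only parsing).

Definition first_test (e : expr) : expr := (Lit 1 - (e - Lit 1))%E.

Definition has_next_test (e : expr) : expr :=
  (Lit 1 - (Lit 1 - e * (Lit 3 - e)))%E.

Lemma first_label_code x : 1 - (label_code x - 1) = first_label x.
Proof. by case: x. Qed.

Lemma has_next_label_code x :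
  1 - (1 - label_code x * (3 - label_code x)) = has_next_label x.
Proof. by case: x. Qed.

Definition next_pos : expr := (Var x_pos + Lit 1)%E.

Definition sibling_pos : expr := (next_pos + Var x_child_size)%E.

Definition scan_relatives (D : nat) : seq stmt :=
  [:: Assign x_child (first_test (Cell a_word next_pos));
      Assign x_child_size (Var x_child * Cell a_size next_pos);
      Assign x_next (has_next_test (Cell a_word (Var x_pos)));
      Assign x_next_size (Var x_next * Cell a_size sibling_pos);
      Assign x_child_rank (Var x_child * Cell (a_rank D) next_pos)].

Definition new_size : expr := (Var x_child_size + Var x_next_size + Lit 1)%E.

Definition new_rank (d : nat) : expr :=
  if d is d'.+1 then
    (entry d new_size (Var x_child_size)
     + Var x_child_rank * count_entry d' (Var x_next_size)
     + Var x_next * Cell (a_rank d') sibling_pos)%E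
  else Lit 0.

Definition store_ranks (D : nat) : seq stmt :=
  [seq Store (a_rank d) (Var x_pos) (new_rank d) | d <- iota 0 D.+1].

Definition store_size_and_step : seq stmt :=
  [:: Store a_size (Var x_pos) new_size; Assign x_pos (Var x_pos - Lit 1)].

Definition scan_step (D : nat) : seq stmt :=
  scan_relatives D ++ store_ranks D ++ store_size_and_step.

Definition scan_start : seq stmt := [:: Assign x_pos (Var x_n - Lit 1)].

Definition scan_result (D : nat) : seq stmt :=
  [:: Assign x_n (Cell (a_rank D) (Lit 1) + Lit 1)].

Definition scan (D : nat) : program :=
  Seq (block scan_start)
      (Seq (while_lt x_zero x_pos (block (scan_step D)))
           (block (scan_result D))).

Section Scan.

Variables (D : nat) (w : seq label) (T : nat -> nat).
Hypothesis T_spec : table_spec D (size w) T.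

Definition at_position (i : nat) (st : state) : Prop :=
  [/\ reg st x_n = size w, reg st x_pos = i & reg st x_zero = 0].

Definition relatives_known (i : nat) (st : state) : Prop :=
  [/\ reg st x_child_size = forest_size (child_forest w i),
      reg st x_next = has_next_label (nth Ls w i),
      reg st x_next_size = forest_size (sibling_forest w i)
    & reg st x_child_rank = forest_rank D D (child_forest w i)].

Definition scanned (i e : nat) (st : state) : Prop :=
  [/\ forall j, arr st a_word j = label_code (nth Ls w j),
      arr st a_table =1 T,
      forall j, i < j -> arr st a_size j = forest_size (forest_at w j)
    & forall d j, d <= D -> (i < j) || (j == i) && (d < e) ->
        arr st (a_rank d) j = forest_rank D d (forest_at w j)].

Lemma run_scan_relatives i st :
  at_position i st -> scanned i 0 st ->
  let st' := run st (scan_relatives D) in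
  [/\ at_position i st', relatives_known i st' & arr st' = arr st].
Proof.
move=> [st_n st_i st_0] [word_ok _ size_ok rank_ok] /=.
have eval_child : 1 - (arr st a_word (reg st x_pos + 1) - 1) =
    first_label (nth Ls w i.+1).
  by rewrite st_i addn1 word_ok first_label_code.
have eval_child_size :
    first_label (nth Ls w i.+1) * arr st a_size (reg st x_pos + 1) =
    forest_size (child_forest w i).
  by rewrite st_i addn1 size_ok // mul_first_labelE.
have eval_next : 1 - (1 - arr st a_word (reg st x_pos) *
    (3 - arr st a_word (reg st x_pos))) = has_next_label (nth Ls w i).
  by rewrite st_i word_ok has_next_label_code.
split=> //.
split; rewrite /= /upd /= ?eval_child ?eval_child_size ?eval_next //.
  by rewrite st_i addn1 size_ok ?mul_has_next_labelE //; lia.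
by rewrite st_i addn1 rank_ok ?leqnn // (@mul_first_labelE w (forest_rank D D)).
Qed.

Lemma eval_new_size i st :
  i < size w -> relatives_known i st ->
  eval st new_size = forest_size (forest_at w i).
Proof.
move=> lti [child_size _ next_size _].
by rewrite /= child_size next_size addn1 forest_atE.
Qed.

Lemma eval_new_rank i d st :
  0 < i -> i < size w -> d <= D -> at_position i st -> relatives_known i st ->
  scanned i d st -> eval st (new_rank d) = forest_rank D d (forest_at w i).
Proof.
move=> i_gt0 lti + [st_n st_i _] known [_ table_ok _ rank_ok].
have size_i := eval_new_size lti known; have := leq_forest_size_at w i.
case: d rank_ok => [|d] rank_ok le_size lt_dD; first by rewrite forest_atE.
case: known => child_size next next_size child_rank.
have sibling_rank : has_next_label (nth Ls w i)
      * arr st (a_rank d) (i.+1 + forest_size (child_forest w i))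
    = forest_rank D d (sibling_forest w i).
  rewrite rank_ok ?(ltnW lt_dD) //; last by lia.
  by rewrite (@mul_has_next_labelE w (forest_rank D d)).
move: size_i le_size.
rewrite forest_atE // forest_size_cons forest_rank_cons /= => size_i le_size.
rewrite child_rank next st_n st_i size_i child_size next_size addn1.
rewrite sibling_rank -!/(table_index _ _ _ _) !table_ok.
rewrite !T_spec ?(ltnW lt_dD) //; try lia.
by rewrite prefix_count_diag.
Qed.

Lemma run_store_ranks i st :
  0 < i -> i < size w ->
  at_position i st -> relatives_known i st -> scanned i 0 st ->
  let st' := run st (store_ranks D) in reg st' = reg st /\ scanned i D.+1 st'.
Proof.
move=> i_gt0 lti pos_i known_i scanned_i.
pose inv d st' := reg st' = reg st /\ scanned i d st'.
apply: (run_map_iota (inv := inv)) => // d st' lt_dD [regE scanned_d].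
split=> //=; rewrite (@eval_new_rank i) /at_position /relatives_known ?regE //.
case: scanned_d => word_ok table_ok size_ok rank_ok.
split=> //= d' j le_dD' done_j.
have [_ -> _] := pos_i; rewrite /upd eqn_add2l.
case: eqP => [eqd|neqd]; last by rewrite rank_ok //; lia.
by case: eqP => [->|neqj]; rewrite eqd // rank_ok //; lia.
Qed.

Definition scan_state (i : nat) (st : state) : Prop :=
  at_position i st /\ scanned i 0 st.

Lemma run_scan_step i st :
  i.+1 < size w -> scan_state i.+1 st -> scan_state i (run st (scan_step D)).
Proof.
move=> lti [pos_i scanned_i]; rewrite /scan_step !run_cat.
have [] := run_scan_relatives pos_i scanned_i.
move: (run st (scan_relatives D)) => st1 pos1 known1 arrE.
have scanned1 : scanned i.+1 0 st1 by rewrite /scanned arrE.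
have [] := run_store_ranks (ltn0Sn i) lti pos1 known1 scanned1.
move: (run st1 (store_ranks D)) => st2 regE [word_ok table_ok size_ok rank_ok].
have [st_n st_i st_0] := pos1.
have size_i := eval_new_size lti known1; rewrite /= in size_i.
split; split; rewrite /= /upd /= ?regE ?size_i ?st_i ?subn1 //=.
  by move=> j lt_ij; case: eqP => [-> //|neq_j]; apply: size_ok; lia.
by move=> d j le_dD lt_ij; apply: rank_ok => //; lia.
Qed.

Definition scan_rate : nat :=
  cost_block scan_start + cost_block (scan_step D)
  + cost_block (scan_result D) + 2.

Lemma terminates_scan st :
  0 < size w -> reg st x_n = size w -> reg st x_zero = 0 ->
  (forall j, arr st a_word j = label_code (nth Ls w j)) ->
  arr st a_table =1 T -> (forall a j, 1 < a -> arr st a j = 0) ->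
  terminates (scan D) (scan_rate * size w) st
    (fun st' => reg st' x_n = (forest_rank D D (forest_at w 1)).+1).
Proof.
move=> w_gt0 st_n st_0 word_ok table_ok empty.
pose inv i st' := i < size w /\ scan_state i st'.
have start : inv (size w).-1 (run st scan_start).
  have past_end j : (size w).-1 < j -> forest_at w j = [::].
    by move=> ltj; apply: forest_at_default; lia.
  split; first lia; split; first by split; rewrite /= /upd //= st_n subn1.
  split=> //= [j ltj|d j _ ltj]; rewrite empty ?past_end //; lia.
have step k st' : inv k.+1 st' ->
    reg st' x_zero < reg st' x_pos /\
    terminates (block (scan_step D)) (cost_block (scan_step D)) st' (inv k).
  case=> ltk state_k; split; first by case: state_k => -[_ -> ->].
  by apply: terminates_block; split; [apply: ltnW|apply: run_scan_step].
have result st' : inv 0 st' -> reg st' x_pos <= reg st' x_zero /\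
    terminates (block (scan_result D)) (cost_block (scan_result D)) st'
      (fun st2 => reg st2 x_n = (forest_rank D D (forest_at w 1)).+1).
  case=> _ [[_ -> ->] [_ _ _ rank_ok]]; split=> //; apply: terminates_block.
  by rewrite /= /upd /= rank_ok ?addn1.
apply: terminates_leq (terminates_seq (terminates_block (terminates_seq
  (terminates_while step result start)))).
rewrite /scan_rate.
move: (cost_block _) (cost_block _) (cost_block _).
by move=> start_cost step_cost result_cost; nia.
Qed.

End Scan.

Lemma ranks_scan D n table t :
  0 < n -> t \in TDelta D n -> table_spec D n (nth 0 table) ->
  ranks (scan D) D n (scan_rate D * n) table t.
Proof.
move=> n_gt0 tT T_spec; have /eqP tn : nnodes t == n by case/andP: tT.
rewrite -tn -size_codeword in n_gt0 T_spec *.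
rewrite /ranks; set st := init_state _ _ _.
have word_ok j : arr st a_word j = label_code (nth Ls (codeword t) j).
  have [ltj|lej] := ltnP j (size (codeword t)); first exact: nth_map.
  rewrite -[LHS]/(nth 0 (map label_code (codeword t)) j).
  by rewrite !nth_default ?size_map.
have empty a j : 1 < a -> arr st a j = 0 by case: a => [|[]].
have [k [mst [st' [ex le_k [regE _] rank_t]]]] :=
  terminates_scan T_spec n_gt0 (erefl : reg st x_n = _) erefl
    word_ok (frefl _) empty (implements_init_state _ _ _).
exists k, mst; split=> //; rewrite -(regE 0) in rank_t.
rewrite rank_t forest_at1_codeword size_codeword tn.
by case: (t) tT => s; apply: is_rank_forest_rank.
Qed.

Theorem theorem5 (Delta : nat) (hDelta : 2 <= Delta) :
  exists (pre rk : program) (C : nat), forall n : nat, 0 < n ->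
    exists table : seq nat,
      [/\ size table <= C * n ^ 2,
          precomputes pre n (C * n ^ 2) table
        & forall t : tree, t \in TDelta Delta n ->
            ranks rk Delta n (C * n) table t].
Proof.
exists (precomputation Delta), (scan Delta).
exists (Delta.+1 + precomputation_rate Delta + scan_rate Delta) => n n_gt0.
have [table [size_table [k [st [ex le_k tableE]]] T_spec]] :=
  precomputes_table Delta n_gt0.
exists table; split.
- by apply: leq_trans size_table _; rewrite leq_mul2r; lia.
- by exists k, st; split=> //; apply: leq_trans le_k _; rewrite leq_mul2r; lia.
- move=> t /(ranks_scan n_gt0)/(_ T_spec) [l [st' [ex' le_l rank_t]]].
  by exists l, st'; split=> //; apply: leq_trans le_l _; rewrite leq_mul2r; lia.
Qed.
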